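(* Let $G$ be a finite group (not necessarily abelian) of order $n$ and let $A_1,\dots,A_m$ be pairwise disjoint subsets of $G$ with sizes $k_1,\dots,k_m$ such that (i) the $A_i$ partition $G^*$, and (ii) every $A_i$ with $|A_i|>1$ has the form $A_i=S_i\setminus\{e\}$ for some subgroup $S_i$ of $G$. Then $\{A_1,\dots,A_m\}$ is a bimodal $(n,m;k_1,\dots,k_m;m-1)$-RWEDF.
   Context: Write $G$ multiplicatively with identity $e$ and $G^*=G\setminus\{e\}$. For $\delta\in G^*$, $N_j(\delta)=|\{(a,b): a\in A_j,\ b\in A_i \text{ for some } i\neq j,\ ab^{-1}=\delta\}|$. The collection is bimodal if $N_j(\delta)\in\{0,k_j\}$ for all $\delta\in G^*$ and all $j$. An $(n,m;k_1,\dots,k_m;\ell)$-RWEDF is a collection of pairwise disjoint subsets with $|A_i|=k_i$ such that $\sum_i \frac{1}{k_i}N_i(\delta)=\ell$ for all $\delta\in G^*$. *)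

(* Defs.v *)
From HB Require Import structures.
From mathcomp Require Import all_boot all_order all_algebra all_fingroup.

Set Implicit Arguments.
Unset Strict Implicit.
Unset Printing Implicit Defensive.

Import GroupScope.

(* N_j(delta) *)
Definition ext_diff_count (gT : finGroupType) (m : nat)
    (A : 'I_m -> {set gT}) (j : 'I_m) (delta : gT) : nat :=
  #|[set p : gT * gT | [&& p.1 \in A j,
       [exists i : 'I_m, (i != j) && (p.2 \in A i)]
       & p.1 * p.2^-1 == delta]]|.

Definition bimodal (gT : finGroupType) (G : {group gT}) (m : nat)
    (A : 'I_m -> {set gT}) : Prop :=
  forall (j : 'I_m) (delta : gT), delta \in G^# ->
    ext_diff_count A j delta = 0%N \/ ext_diff_count A j delta = #|A j|.

(* The parameter l is a rational number, since the weighted sum need not be an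
   integer a priori.  The condition 0 < k i is what gives 1 / k_i a meaning:
   inversion is total here, with 0^-1 = 0. *)
Definition is_RWEDF (gT : finGroupType) (G : {group gT}) (n m : nat)
    (k : 'I_m -> nat) (l : rat) (A : 'I_m -> {set gT}) : Prop :=
  [/\ #|G| = n,
      forall i, A i \subset G,
      forall i j, i != j -> [disjoint A i & A j],
      forall i, (0 < k i)%N /\ #|A i| = k i
    & forall delta : gT, delta \in G^# ->
        (\sum_(i < m) (k i)%:R^-1 * (ext_diff_count A i delta)%:R)%R = l].

(* Main.v *)
Require Import Defs.
From HB Require Import structures.
From mathcomp Require Import all_boot all_order all_algebra all_fingroup.

Set Implicit Arguments.
Unset Strict Implicit.
Unset Printing Implicit Defensive.

Import GroupScope GRing.Theory Num.Theory.

(** The elements [a] of [A j] for which [delta = a * b^-1] has a solution [b]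
    in another block form the intersection of [A j] with [delta *: U], where
    [U] is the union of the other blocks. When the blocks partition [G^#], [U]
    is the complement of [1 |: A j] in [G], and the intersection becomes
    [A j :\: delta *: (1 |: A j)]. If [1 |: A j] is a subgroup [S], then
    [delta *: S] is [S] or is disjoint from [S]; a singleton [A j] shows the
    same alternative. Hence [N_j(delta)] is [0] if [A j] contains [delta], which
    happens for exactly one [j], and [#|A j|] otherwise. *)

Lemma bigcup_disjointD1 (I T : finType) (A : I -> {set T}) (j : I) :
    (forall i i', i != i' -> [disjoint A i & A i']) ->
  \bigcup_(i | i != j) A i = (\bigcup_i A i) :\: A j.
Proof.
move=> disjA; rewrite [X in X :\: _](bigD1 j) //= setDUl setDv set0U.
apply/esym/setDidPl; rewrite disjoint_sym; apply: bigcup_disjoint => i.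
by rewrite eq_sym => /disjA.
Qed.

Section LcosetDichotomy.

Variable gT : finGroupType.

Definition lcoset_dichotomic (B : {set gT}) : Prop :=
  forall d, B :\: d *: (1 |: B) = if d \in 1 |: B then set0 else B.

Lemma group_setD1_lcoset_dichotomic (S : {group gT}) : lcoset_dichotomic S^#.
Proof.
move=> d; rewrite setD1K //; case: ifPn => [Sd | S'd].
  by rewrite lcoset_id //; apply/eqP; rewrite setD_eq0 subsetDl.
apply/setDidPl; rewrite disjoint_subset; apply/subsetP => x /setD1P[_ Sx].
by rewrite inE mem_lcoset groupMr // groupV.
Qed.

Lemma set1_lcoset_dichotomic (x : gT) : lcoset_dichotomic [set x].
Proof.
move=> d; have mem_dx : (x \in d *: [set 1; x]) = (d \in [set 1; x]).
  rewrite mem_lcoset !inE -eq_mulVg1 orbC -{2}[x]mul1g (inj_eq (mulIg x)).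
  by rewrite invg_eq1.
case: ifPn; rewrite -mem_dx => dx.
  by apply/eqP; rewrite setD_eq0 sub1set.
by apply/setDidPl; rewrite disjoints1.
Qed.

End LcosetDichotomy.

Lemma ext_diff_count_lcoset (gT : finGroupType) (m : nat)
    (A : 'I_m -> {set gT}) (j : 'I_m) (d : gT) :
  ext_diff_count A j d = #|A j :&: d *: (\bigcup_(i | i != j) A i)|.
Proof.
have pair_inj : injective (fun a => (a, d^-1 * a)) by move=> a a' [].
rewrite /ext_diff_count -(card_imset _ pair_inj); apply: eq_card => -[a b].
rewrite inE /=; apply/and3P/imsetP.
  move=> [Aa /existsP[i /andP[ne_ij Ab]] /eqP def_d].
  have def_b : b = d^-1 * a by rewrite -def_d invMg invgK mulgKV.
  exists a; last by rewrite def_b.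
  by rewrite inE Aa mem_lcoset -def_b; apply/bigcupP; exists i.
move=> [a' /setIP[Aa']]; rewrite mem_lcoset => /bigcupP[i ne_ij Ai] [-> ->].
split=> //; first by apply/existsP; exists i; rewrite ne_ij.
by rewrite invMg invgK mulKVg.
Qed.

Section DichotomicPartition.

Variables (gT : finGroupType) (G : {group gT}) (m : nat) (A : 'I_m -> {set gT}).
Hypothesis bigcupA : \bigcup_i A i = G^#.

Lemma block_subG (i : 'I_m) : A i \subset G.
Proof.
by apply: subset_trans (subsetDl G 1); rewrite -bigcupA; apply: bigcup_sup.
Qed.

Hypothesis disjA : forall i j, i != j -> [disjoint A i & A j].

Lemma ext_diff_count_dichotomic (j : 'I_m) (d : gT) :
    lcoset_dichotomic (A j) -> d \in G^# ->
  ext_diff_count A j d = if d \in A j then 0 else #|A j|.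
Proof.
move=> dichAj /setD1P[nt_d Gd].
have -> : ext_diff_count A j d = #|A j :\: d *: (1 |: A j)|.
  rewrite ext_diff_count_lcoset bigcup_disjointD1 // bigcupA setDDl.
  apply: eq_card => a; rewrite inE in_setD andbC !mem_lcoset in_setD.
  apply: andb_id2r => /(subsetP (block_subG j)) Ga.
  by rewrite groupM ?groupV // andbT.
by rewrite dichAj in_setU1 (negPf nt_d) /=; case: ifP; rewrite ?cards0.
Qed.

Hypothesis dichA : forall i, lcoset_dichotomic (A i).

Lemma bimodal_dichotomic : bimodal G A.
Proof.
move=> j d Gd; rewrite ext_diff_count_dichotomic //.
by case: ifP; [left | right].
Qed.

Lemma sum_ext_diff_count_dichotomic (F : numFieldType) (d : gT) :
    (forall i, A i != set0) -> d \in G^# ->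
  (\sum_(i < m) #|A i|%:R^-1 * (ext_diff_count A i d)%:R = m%:R - 1 :> F)%R.
Proof.
move=> ntA Gd; have /bigcupP[j _ Aj_d] : d \in \bigcup_i A i by rewrite bigcupA.
have -> : (m%:R - 1 = \sum_(i < m | i != j) 1 :> F)%R.
  rewrite -[X in X%:R%R]card_ord -sumr_const (bigD1 j) //=.
  by rewrite addrAC subrr add0r.
rewrite (bigD1 j) //= ext_diff_count_dichotomic // Aj_d mulr0 add0r.
apply: eq_bigr => i ne_ij.
rewrite ext_diff_count_dichotomic // (disjointFl (disjA ne_ij) Aj_d).
by rewrite mulVf // pnatr_eq0 cards_eq0.
Qed.

End DichotomicPartition.

Theorem mainTheorem15 (gT : finGroupType) (G : {group gT}) (n m : nat)
    (k : 'I_m -> nat) (A : 'I_m -> {set gT})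
    (hn : #|G| = n)
    (hk : forall i, #|A i| = k i)
    (hdisj : forall i j, i != j -> [disjoint A i & A j])
    (hpart : partition [set A i | i : 'I_m] G^#)
    (hsub : forall i, (1 < #|A i|)%N ->
       exists2 S : {group gT}, S \subset G & A i = S^#) :
  bimodal G A /\ is_RWEDF G n k (m%:R - 1)%R A.
Proof.
have bigcupA : \bigcup_i A i = G^#.
  by rewrite -(cover_partition hpart) cover_imset.
have ntA i : A i != set0 by apply: partition_neq0 hpart (imset_f _ _).
have dichA i : lcoset_dichotomic (A i).
  have [/hsub[S _ ->] | leA1] := ltnP 1 #|A i|.
    exact: group_setD1_lcoset_dichotomic.
  have /cards1P[x ->] : #|A i| == 1%N by rewrite eqn_leq leA1 card_gt0 ntA.
  exact: set1_lcoset_dichotomic.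
split; first exact: bimodal_dichotomic.
split=> // [i | i | d Gd].
- exact: block_subG bigcupA i.
- by rewrite -hk card_gt0 ntA.
under eq_bigr do rewrite -hk.
exact: sum_ext_diff_count_dichotomic Gd.
Qed.
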